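(* Let $S$ be a quasiregular pseudocompact topological semigroup which is algebraically a primitive inverse semigroup, $S=\sum_{i\in\mathscr I}B_{\lambda_i}(G_i)$. Then the family of all sets $S\setminus\big((G_{i_1})_{\alpha_1,\beta_1}\cup\dots\cup(G_{i_k})_{\alpha_k,\beta_k}\big)$, where $k\in\mathbb N$, $i_1,\dots,i_k\in\mathscr I$ and $\alpha_j,\beta_j\in\lambda_{i_j}$, is a base of the topology of $S$ at zero.
   Context: All spaces are Hausdorff; a topological semigroup is a Hausdorff space with jointly continuous associative operation. A space $X$ is quasiregular if every non-empty open $U$ contains a non-empty open $V$ with $\operatorname{cl}_X V\subseteq U$; pseudocompact: every locally finite family of non-empty open sets is finite. For a group $G$ and cardinal $\lambda\ge1$, $B_\lambda(G)=(\lambda\times G\times\lambda)\cup\{0\}$ with $(\alpha,a,\beta)(\gamma,b,\delta)=(\alpha,ab,\delta)$ if $\beta=\gamma$ and $0$ otherwise. The orthogonal sum of semigroups $T_\iota$ with zeros is $\{0\}\cup\bigcup_\iota(T_\iota\setminus\{0_\iota\})$ with products computed in $T_\iota$ when both factors lie in the same $T_\iota$ and the product is non-zero, and $0$ otherwise. Primitive inverse semigroups are exactly orthogonal sums $\sum_{i\in\mathscr I}B_{\lambda_i}(G_i)$; we identify $B_{\lambda_i}(G_i)$ with a subsemigroup of $S$ and write $(G_i)_{\alpha,\beta}=\{(\alpha,g,\beta):g\in G_i\}$. *)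

(* Defs.v *)
From Stdlib Require Import Classical ClassicalEpsilon List.

Record Group := {
  gcar :> Type;
  gmul : gcar -> gcar -> gcar;
  gone : gcar;
  ginv : gcar -> gcar;
  gmul_assoc : forall a b c, gmul a (gmul b c) = gmul (gmul a b) c;
  gmul_1l : forall a, gmul gone a = a;
  gmul_1r : forall a, gmul a gone = a;
  gmul_Vl : forall a, gmul (ginv a) a = gone;
  gmul_Vr : forall a, gmul a (ginv a) = gone
}.

(** Orthogonal sum  sum_{i in I} B_{L i}(G i): zero is [None], the element
    (alpha, g, beta) of the i-th Brandt semigroup is [Some (existT _ i (alpha,g,beta))]. *)
Definition BTriple (I : Type) (L : I -> Type) (G : I -> Group) (i : I) : Type :=
  (L i * G i * L i)%type.
Arguments BTriple {I} L G i.

Definition OSum (I : Type) (L : I -> Type) (G : I -> Group) : Type :=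
  option {i : I & BTriple L G i}.
Arguments OSum {I} L G.

Definition osum_mul (I : Type) (L : I -> Type) (G : I -> Group)
  (x y : OSum L G) : OSum L G :=
  match x, y with
  | Some (existT _ i (a, g, b)), Some (existT _ j (c, h, d)) =>
      match excluded_middle_informative (i = j) with
      | left e =>
          let c' := eq_rect_r L c e in
          let h' := eq_rect_r (fun k => gcar (G k)) h e in
          let d' := eq_rect_r L d e in
          if excluded_middle_informative (b = c')
          then Some (existT (BTriple L G) i (a, gmul (G i) g h', d'))
          else None
      | right _ => None
      end
  | _, _ => None
  end.
Arguments osum_mul {I L G} x y.

Definition Hsub (I : Type) (L : I -> Type) (G : I -> Group)
  (t : {i : I & (L i * L i)%type}) (x : OSum L G) : Prop :=
  match t with
  | existT _ i (a, b) => exists g : G i, x = Some (existT (BTriple L G) i (a, g, b))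
  end.
Arguments Hsub {I L G} t x.

Record topology (X : Type) := {
  is_open : (X -> Prop) -> Prop;
  open_full : is_open (fun _ => True);
  open_inter : forall U V, is_open U -> is_open V -> is_open (fun x => U x /\ V x);
  open_union : forall F : (X -> Prop) -> Prop, (forall U, F U -> is_open U) ->
      is_open (fun x => exists U, F U /\ U x)
}.
Arguments is_open {X} t U.

Definition hausdorff {X : Type} (t : topology X) : Prop :=
  forall x y : X, x <> y -> exists U V, is_open t U /\ is_open t V /\ U x /\ V y /\
     (forall z, U z -> V z -> False).

Definition jointly_continuous {X : Type} (t : topology X) (m : X -> X -> X) : Prop :=
  forall x y W, is_open t W -> W (m x y) ->
    exists U V, is_open t U /\ is_open t V /\ U x /\ V y /\
      (forall u v, U u -> V v -> W (m u v)).

Definition topological_semigroup {X : Type} (t : topology X) (m : X -> X -> X) : Prop :=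
  hausdorff t /\ (forall a b c, m a (m b c) = m (m a b) c) /\ jointly_continuous t m.

Definition closure {X : Type} (t : topology X) (A : X -> Prop) (x : X) : Prop :=
  forall U, is_open t U -> U x -> exists y, U y /\ A y.

Definition quasiregular {X : Type} (t : topology X) : Prop :=
  forall U, is_open t U -> (exists x, U x) ->
    exists V, is_open t V /\ (exists x, V x) /\ (forall x, closure t V x -> U x).

Definition finite_family {X : Type} (F : (X -> Prop) -> Prop) : Prop :=
  exists l : list (X -> Prop), forall U, F U -> In U l.

Definition locally_finite {X : Type} (t : topology X) (F : (X -> Prop) -> Prop) : Prop :=
  forall x, exists O, is_open t O /\ O x /\
    finite_family (fun U => F U /\ exists y, O y /\ U y).

Definition pseudocompact {X : Type} (t : topology X) : Prop :=
  forall F : (X -> Prop) -> Prop,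
    (forall U, F U -> is_open t U /\ exists x, U x) ->
    locally_finite t F -> finite_family F.

(* Main.v *)
Require Import Defs.
From Stdlib Require Import Classical ClassicalEpsilon List.
From Stdlib Require Import FunctionalExtensionality PropExtensionality Lia Eqdep.

(** Write x' for the inverse of x, which is not assumed to be continuous, and let H be
    the open maximal subgroup at a non-zero idempotent e.
    (1) Every neighbourhood U of e contains a non-empty open A with A' inside cl U.
    Otherwise, with V V inside U, quasiregularity gives open A_n and points y_n of A_n with
    cl A_(n+1) inside A_n and y_n V, while B_n = {w in A_n : w in y_(n+1) O_n} contains y_n
    and y_(n+1) O_n misses y_(n+1) U.  A cluster point y of the B_n lies in all A_n, so
    y_(n+1)' b = (y_(n+1)' y)(y' b) is in V V for some b in B_n, a contradiction.
    (2) Zero is not in cl H.  Otherwise choose k_n in H so near zero that k_n' k_m is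
    close to zero for n < m; the open sets U k_n' stay away from zero, so they cluster at some
    y in H, and comparing two of them near y puts a point of U U (cl U) U (k_n' k_m) in U,
    which is impossible for small U since zero absorbs.
    By translation, every H-class is clopen.
    (3) If V is an open neighbourhood of zero, the interiors of the sets H_(a,b) \ V form a
    locally finite family, so V is dense in all but finitely many H_(a,b).  By (1), inverses of
    non-empty open subsets of H have interior, hence V V contains H_(a,b) as soon as V is
    dense in H_(a,b) and in one of H_(a,a), H_(b,b). *)

(** * Choice and finiteness *)

Lemma dependent_choice (T : Type) (P : T -> Prop) (R : T -> T -> Prop) (s0 : T) :
  P s0 -> (forall s, P s -> exists s', P s' /\ R s s') ->
  exists f : nat -> T, forall n, P (f n) /\ R (f n) (f (S n)).
Proof.
  intros P0 step.
  assert (stepS : forall s : sig P, exists s' : sig P, R (proj1_sig s) (proj1_sig s')).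
  { intros [s Ps]. destruct (step s Ps) as [s' [Ps' Rs]]. exists (exist P s' Ps'). exact Rs. }
  pose (next := fun s => proj1_sig (constructive_indefinite_description _ (stepS s))).
  pose (f := nat_rect (fun _ => sig P) (exist P s0 P0) (fun _ s => next s)).
  exists (fun n => proj1_sig (f n)). intro n. split.
  - exact (proj2_sig (f n)).
  - exact (proj2_sig (constructive_indefinite_description _ (stepS (f n)))).
Qed.

Lemma decreasing_le (T : Type) (F : nat -> T -> Prop) :
  (forall n x, F (S n) x -> F n x) -> forall m n x, n <= m -> F m x -> F n x.
Proof. intros dec m n x le. induction le; auto. Qed.

Lemma finite_preimage (A B : Type) (f : A -> B) (l : list B) :
  forall P : A -> Prop, (forall x, P x -> In (f x) l) ->
  (forall x y, P x -> P y -> f x = f y -> x = y) ->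
  exists l', forall x, P x -> In x l'.
Proof.
  induction l as [|b l IH]; intros P cov inj.
  - exists nil. exact cov.
  - destruct (IH (fun x => P x /\ f x <> b)) as [l' Hl'].
    + intros x [Px ne]. destruct (cov x Px) as [e|i]; [congruence | exact i].
    + intros x y [Px _] [Py _]. auto.
    + destruct (classic (exists x, P x /\ f x = b)) as [[x [Px e]]|no].
      * exists (x :: l'). intros y Py. destruct (classic (f y = b)) as [e'|ne].
        -- left. apply inj; congruence.
        -- right. auto.
      * exists l'. intros y Py. apply Hl'. split; [exact Py|]. intro e. apply no. eauto.
Qed.

Lemma infinite_pigeonhole (T : Type) (l : list T) :
  forall (f : nat -> T) (N : nat), (forall n, N <= n -> In (f n) l) ->
  exists x, forall M, exists n, M <= n /\ f n = x.
Proof.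
  induction l as [|a l IH]; intros f N cov.
  - destruct (cov N (le_n N)).
  - destruct (classic (forall M, exists n, M <= n /\ f n = a)) as [inf|fin]; [eauto|].
    apply not_all_ex_not in fin. destruct fin as [M fin].
    apply (IH f (N + M)). intros n le. destruct (cov n) as [e|i]; [lia| |exact i].
    exfalso. apply fin. exists n. split; [lia | congruence].
Qed.

(** * Cluster points and continuity in topological spaces *)

Section Topology.
Context {X : Type} (t : topology X).

Lemma open_local (U : X -> Prop) :
  (forall x, U x -> exists V, is_open t V /\ V x /\ forall y, V y -> U y) -> is_open t U.
Proof.
  intro loc.
  replace U with (fun x => exists V, (is_open t V /\ forall y, V y -> U y) /\ V x).
  - apply open_union. tauto.
  - apply functional_extensionality. intro x. apply propositional_extensionality. split.
    + intros [V [[_ sub] Vx]]. auto.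
    + intro Ux. destruct (loc x Ux) as [V [oV [Vx sub]]]. eauto.
Qed.

Lemma open_neq (a : X) : hausdorff t -> is_open t (fun x => x <> a).
Proof.
  intro haus. apply open_local. intros x ne.
  destruct (haus x a ne) as [U [V [oU [_ [Ux [Va dis]]]]]].
  exists U. repeat split; auto. intros y Uy e. subst. eauto.
Qed.

(** Without a cluster point the sets B_n form a locally finite, hence finite, family. As the B_n may
    repeat, the pigeonhole is still needed: some set equals B_n for infinitely many n, and each of
    its points is a cluster point. *)
Lemma pseudocompact_cluster (B : nat -> X -> Prop) :
  pseudocompact t -> (forall n, is_open t (B n) /\ exists x, B n x) ->
  exists y, forall O, is_open t O -> O y ->
    forall N, exists n, N <= n /\ exists w, O w /\ B n w.
Proof.
  intros pc HB. apply NNPP. intro no.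
  assert (far : forall y, exists O N, is_open t O /\ O y /\
            forall n w, N <= n -> O w -> B n w -> False).
  { intro y. apply NNPP. intro far. apply no. exists y. intros O oO Oy N.
    apply NNPP. intro hit. apply far. exists O, N. repeat split; auto.
    intros n w le Ow Bw. apply hit. eauto. }
  destruct (pc (fun U => exists n, U = B n)) as [l Hl].
  - intros U [n ->]. apply HB.
  - intro y. destruct (far y) as [O [N [oO [Oy dis]]]]. exists O. repeat split; auto.
    exists (map B (seq 0 N)). intros U [[n ->] [w [Ow Bw]]]. apply in_map, in_seq.
    destruct (Compare_dec.le_lt_dec N n) as [le|lt]; [exfalso; eauto | lia].
  - destruct (infinite_pigeonhole _ l B 0) as [U inf]; [eauto|].
    destruct (inf 0) as [n [_ e]]. destruct (HB n) as [_ [x Bx]].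
    destruct (far x) as [O [N [_ [Ox dis]]]]. destruct (inf N) as [k [le e']].
    apply (dis k x le Ox). congruence.
Qed.

Lemma open_preimage_l (m : X -> X -> X) (a : X) (W : X -> Prop) :
  jointly_continuous t m -> is_open t W -> is_open t (fun x => W (m a x)).
Proof.
  intros jc oW. apply open_local. intros x Wx.
  destruct (jc a x W oW Wx) as [U [V [_ [oV [Ua [Vx sub]]]]]]. exists V. auto.
Qed.

Lemma open_preimage_r (m : X -> X -> X) (a : X) (W : X -> Prop) :
  jointly_continuous t m -> is_open t W -> is_open t (fun x => W (m x a)).
Proof.
  intros jc oW. apply open_local. intros x Wx.
  destruct (jc x a W oW Wx) as [U [V [oU [_ [Ux [Va sub]]]]]]. exists U. auto.
Qed.

Lemma square_nbhd (m : X -> X -> X) (e : X) (W : X -> Prop) :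
  jointly_continuous t m -> is_open t W -> W (m e e) ->
  exists V, is_open t V /\ V e /\ forall x y, V x -> V y -> W (m x y).
Proof.
  intros jc oW We. destruct (jc e e W oW We) as [U [V [oU [oV [Ue [Ve sub]]]]]].
  exists (fun x => U x /\ V x). split; [now apply open_inter|]. split; [auto|].
  intros x y [Ux _] [_ Vy]. auto.
Qed.

End Topology.

(** * Primitive inverse semigroups and the calculus of their H-classes *)

Record primitive_inverse {X : Type} (m : X -> X -> X) (z : X) (inv : X -> X) : Prop := {
  mulA : forall x y w, m x (m y w) = m (m x y) w;
  mul0l : forall x, m z x = z;
  mul0r : forall x, m x z = z;
  mulVK : forall x, m (m x (inv x)) x = x;
  invK : forall x, inv (inv x) = x;
  primitive : forall x y, m x y <> z -> m (inv x) x = m y (inv y)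
}.

(** In [B_lambda(G)] this is [G_{alpha,beta}] for [a = (alpha,1,alpha)], [b = (beta,1,beta)]. *)
Definition Hclass {X : Type} (m : X -> X -> X) (z : X) (inv : X -> X) (a b x : X) : Prop :=
  x <> z /\ m x (inv x) = a /\ m (inv x) x = b.

Section Algebra.
Context {X : Type} {m : X -> X -> X} {z : X} {inv : X -> X}.
Context (PI : primitive_inverse m z inv).
Local Infix "*" := m.
Local Notation "x ^'" := (inv x) (at level 3, format "x ^'").
Local Notation Hc := (Hclass m z inv).

Lemma mul_VK x : x * (x^' * x) = x.
Proof. rewrite (mulA _ _ _ PI). apply (mulVK _ _ _ PI). Qed.

Lemma invVK x : x^' * (x * x^') = x^'.
Proof. generalize (mul_VK (x^')). now rewrite (invK _ _ _ PI). Qed.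

Lemma mul_nz_l x y : x * y <> z -> x <> z.
Proof. intros nz e. apply nz. rewrite e. apply (mul0l _ _ _ PI). Qed.

Lemma mul_nz_r x y : x * y <> z -> y <> z.
Proof. intros nz e. apply nz. rewrite e. apply (mul0r _ _ _ PI). Qed.

Lemma H_unit_l a b x : Hc a b x -> a * x = x.
Proof. intros [_ [<- _]]. rewrite <- (mulA _ _ _ PI). apply mul_VK. Qed.

Lemma H_unit_r a b x : Hc a b x -> x * b = x.
Proof. intros [_ [_ <-]]. apply mul_VK. Qed.

Lemma H_inv a b x : Hc a b x -> Hc b a (x^').
Proof.
  intros [nz [ea eb]]. repeat split; rewrite ?(invK _ _ _ PI); auto.
  intro e. apply nz. rewrite <- (mul_VK x), e. rewrite (mul0l _ _ _ PI). apply (mul0r _ _ _ PI).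
Qed.

Lemma H_mul a b c x y : Hc a b x -> Hc b c y -> Hc a c (x * y).
Proof.
  intros Hx Hy.
  assert (nz : x * y <> z).
  { intro e. apply (proj1 Hy). rewrite <- (H_unit_l _ _ _ Hy).
    destruct Hx as [_ [_ <-]]. rewrite <- (mulA _ _ _ PI), e. apply (mul0r _ _ _ PI). }
  assert (ex : x^' * (x * y) = y).
  { rewrite (mulA _ _ _ PI). destruct Hx as [_ [_ ->]]. exact (H_unit_l _ _ _ Hy). }
  assert (ey : x * y * y^' = x).
  { rewrite <- (mulA _ _ _ PI). destruct Hy as [_ [-> _]]. exact (H_unit_r _ _ _ Hx). }
  repeat split; [exact nz| |].
  (* The products x' (xy) = y and (xy) y' = x are non-zero, so [primitive] identifies the
     idempotents of xy with those of x and y. *)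
  - rewrite <- (primitive _ _ _ PI (x^') (x * y)).
    + rewrite (invK _ _ _ PI). apply Hx.
    + rewrite ex. apply Hy.
  - rewrite (primitive _ _ _ PI (x * y) (y^')).
    + rewrite (invK _ _ _ PI). apply Hy.
    + rewrite ey. apply Hx.
Qed.

(** (xy)' = (xy)' a with a = x x' = x (y y') x', and then (xy)' (xy) = c = y' y is absorbed by
    y'. *)
Lemma inv_mul a b c x y : Hc a b x -> Hc b c y -> (x * y)^' = y^' * x^'.
Proof.
  intros Hx Hy. destruct (H_mul _ _ _ _ _ Hx Hy) as [_ [ea ec]].
  rewrite <- (invVK (x * y)), ea. destruct (Hx) as [_ [<- _]].
  rewrite <- (H_unit_r _ _ _ Hx) at 2. destruct Hy as [Hy0 [<- ec']].
  rewrite <- (invVK y) at 2. rewrite !(mulA _ _ _ PI), <- (mulA _ _ _ PI _ x y), ec, <- ec'. reflexivity.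
Qed.

Lemma H_idem_l a b x : Hc a b x -> Hc a a a.
Proof.
  intro Hx. assert (Ha := H_mul _ _ _ _ _ Hx (H_inv _ _ _ Hx)).
  destruct (Hx) as [_ [ea _]]. now rewrite ea in Ha.
Qed.

Lemma H_idem_r a b x : Hc a b x -> Hc b b b.
Proof. intro Hx. exact (H_idem_l _ _ _ (H_inv _ _ _ Hx)). Qed.

Lemma H_sandwich a b x : Hc a a a -> Hc b b b -> a * (x * b) <> z -> Hc a b x.
Proof.
  intros Ha Hb nz. repeat split.
  - exact (mul_nz_l _ _ (mul_nz_r _ _ nz)).
  - rewrite <- (primitive _ _ _ PI a x); [apply Ha|].
    rewrite (mulA _ _ _ PI) in nz. exact (mul_nz_l _ _ nz).
  - rewrite (primitive _ _ _ PI x b); [apply Hb|]. exact (mul_nz_r _ _ nz).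
Qed.

End Algebra.

(** * Open H-classes and inversion in the maximal subgroups *)

Section TopologicalPrimitiveInverse.
Context {X : Type} {m : X -> X -> X} {z : X} {inv : X -> X} (t : topology X).
Context (PI : primitive_inverse m z inv).
Context (haus : hausdorff t) (jc : jointly_continuous t m).
Context (qr : quasiregular t) (pc : pseudocompact t).
Local Infix "*" := m.
Local Notation "x ^'" := (inv x) (at level 3, format "x ^'").
Local Notation Hc := (Hclass m z inv).
Local Notation mA := (mulA _ _ _ PI).

(** By [H_sandwich] the class consists of the y with a y b non-zero, and the complement of zero is
    open. *)
Lemma H_open a b x : Hc a b x -> is_open t (Hc a b).
Proof.
  intro Hx. apply open_local. intros y Hy.
  exists (fun y => a * (y * b) <> z). split; [|split].
  - apply (open_preimage_r t m b (fun u => a * u <> z) jc).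
    apply (open_preimage_l t m a (fun u => u <> z) jc). now apply open_neq.
  - rewrite (H_unit_r PI _ _ _ Hy), (H_unit_l PI _ _ _ Hy). apply Hy.
  - intros w. apply (H_sandwich PI); [exact (H_idem_l PI _ _ _ Hx) | exact (H_idem_r PI _ _ _ Hx)].
Qed.

Lemma inverse_in_closure e (U : X -> Prop) :
  Hc e e e -> is_open t U -> U e ->
  exists A, is_open t A /\ (exists p, A p) /\
    forall x, A x -> U x /\ Hc e e x /\ closure t U (x^').
Proof.
  intros He oU Ue. apply NNPP. intro no.
  assert (ee : e * e = e) by exact (H_unit_l PI _ _ _ He).
  assert (oH := H_open _ _ _ He).
  assert (far : forall A, is_open t A -> (exists p, A p) ->
    (forall x, A x -> U x /\ Hc e e x) ->
    exists x O, A x /\ is_open t O /\ O (x^') /\ forall u, O u -> U u -> False).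
  { intros A oA neA sub. apply NNPP. intro far. apply no. exists A.
    split; [exact oA|]. split; [exact neA|]. intros x Ax.
    destruct (sub x Ax) as [Ux Hx]. split; [exact Ux|]. split; [exact Hx|].
    intros O oO Ox. apply NNPP. intro dis. apply far. exists x, O. eauto 7. }
  destruct (square_nbhd t m e U jc oU) as [V [oV [Ve VV]]]; [now rewrite ee|].
  (* A state is a pair (A_n, y_n); the clauses of [R] are cl A_(n+1) inside A_n, A_(n+1) inside y_n
     V, and the existence of B_n. *)
  pose (P := fun s : (X -> Prop) * X =>
    is_open t (fst s) /\ fst s (snd s) /\ forall x, fst s x -> Hc e e x).
  pose (R := fun s s' : (X -> Prop) * X =>
    (forall w, closure t (fst s') w -> fst s w) /\
    (forall w, fst s' w -> V ((snd s)^' * w)) /\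
    exists B, is_open t B /\ (exists w, B w) /\
      forall w, B w -> fst s w /\ ~ U ((snd s')^' * w)).
  destruct (dependent_choice _ P R (Hc e e, e)) as [f Hf].
  - split; [exact oH|]. split; [exact He | auto].
  - intros [A y] [oA [Ay AH]]. unfold P, R. simpl in *.
    assert (Hy := AH y Ay).
    assert (yy : y^' * y = e) by apply Hy.
    assert (yy' : y * y^' = e) by apply Hy.
    pose (Q := fun w => A w /\ V (y^' * w)).
    destruct (qr Q) as [A1 [oA1 [[q A1q] cl]]].
    { apply open_inter; [exact oA|]. now apply open_preimage_l. }
    { exists y. split; [exact Ay|]. now rewrite yy. }
    assert (A1Q : forall w, A1 w -> Q w).
    { intros w A1w. apply cl. intros O _ Ow. eauto. }
    assert (yK : forall w, A1 w -> y * (y^' * w) = w).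
    { intros w A1w. rewrite mA, yy'. apply (H_unit_l PI e e). apply AH, A1Q, A1w. }
    (* The bad point x is sought in the translate y' A1, so that y x lies in A1 and serves as the
       next point; x' has a neighbourhood O missing U. *)
    destruct (far (fun x => (A1 (y * x) /\ Hc e e x) /\ V x)) as [x [O [[[A1x Hx] Vx] [oO [Ox dis]]]]].
    { apply open_inter; [apply open_inter|]; auto. now apply open_preimage_l. }
    { exists (y^' * q). split; [split|].
      - now rewrite yK.
      - apply (H_mul PI e e e); [now apply (H_inv PI)|]. apply AH, A1Q, A1q.
      - apply A1Q, A1q. }
    { intros x [[_ Hx] Vx]. split; [|exact Hx].
      rewrite <- (H_unit_r PI _ _ _ Hx). auto. }
    exists (A1, y * x). simpl. split; [|split; [|split]].
    + split; [exact oA1|]. split; [exact A1x|]. intros w A1w. apply AH, A1Q, A1w.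
    + intros w clw. apply cl, clw.
    + intros w A1w. apply A1Q, A1w.
    (* This set contains y because (y x)' y = x' y' y = x'. *)
    + exists (fun w => A w /\ O ((y * x)^' * w)). split; [|split].
      * apply open_inter; [exact oA|]. now apply open_preimage_l.
      * exists y. split; [exact Ay|].
        rewrite (inv_mul PI e e e y x Hy Hx), <- mA, yy.
        now rewrite (H_unit_r PI e e _ (H_inv PI _ _ _ Hx)).
      * intros w [Aw Ow]. split; [exact Aw|]. eauto.
  - destruct (choice (fun n B => is_open t B /\ (exists w, B w) /\
      forall w, B w -> fst (f n) w /\ ~ U ((snd (f (S n)))^' * w))) as [B HB].
    { intro n. apply (Hf n). }
    destruct (pseudocompact_cluster t B pc) as [y Hy].
    { intro n. destruct (HB n) as [oB [neB _]]. auto. }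
    assert (dec : forall k n w, n <= k -> fst (f k) w -> fst (f n) w).
    { apply decreasing_le. intros n w fw. apply (Hf n). intros O _ Ow. eauto. }
    assert (yA : forall n, fst (f n) y).
    { intro n. apply (Hf n). intros O oO Oy.
      destruct (Hy O oO Oy (S n)) as [k [le [w [Ow Bw]]]].
      exists w. split; [exact Ow|]. apply (dec k); [exact le|]. now apply HB. }
    assert (HyH : Hc e e y) by apply (Hf 0), yA.
    destruct (Hy (fun w => Hc e e w /\ V (y^' * w))) with (N := 0)
      as [n [_ [b [[Hb Vb] Bb]]]].
    { apply open_inter; [exact oH|]. now apply open_preimage_l. }
    { split; [exact HyH|]. now replace (y^' * y) with e by (symmetry; apply HyH). }
    apply (proj2 (proj2 (proj2 (HB n)) b Bb)).
    (* One index further on: y lies in A_(n+2), which is inside y_(n+1) V. *)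
    assert (Vy : V ((snd (f (S n)))^' * y)) by apply (Hf (S n)), yA.
    replace ((snd (f (S n)))^' * b) with ((snd (f (S n)))^' * y * (y^' * b)); [auto|].
    rewrite <- mA, (mA y), (proj1 (proj2 HyH)). now rewrite (H_unit_l PI _ _ _ Hb).
Qed.

(** Quasiregularity removes the closure from [inverse_in_closure]: choose O1 with cl O1 inside O and
    q in O1, and apply that lemma to the neighbourhood q' O1 of e. The inverses of A q' lie in q cl
    (q' O1), hence in cl O1. *)
Lemma inverse_open_image e (O : X -> Prop) :
  is_open t O -> (exists x, O x) -> (forall x, O x -> Hc e e x) ->
  exists A, is_open t A /\ (exists p, A p) /\ forall x, A x -> Hc e e x /\ O (x^').
Proof.
  intros oO neO OH. destruct (qr O oO neO) as [O1 [oO1 [[q Oq] cl]]].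
  assert (Hq : Hc e e q). { apply OH, cl. intros N _ Nq. eauto. }
  assert (He := H_idem_l PI _ _ _ Hq).
  assert (Hq' := H_inv PI _ _ _ Hq).
  destruct (inverse_in_closure e (fun w => O1 (q * w))) as [A [oA [[p Ap] HA]]].
  - exact He.
  - now apply open_preimage_l.
  - now rewrite (H_unit_r PI _ _ _ Hq).
  - exists (fun w => Hc e e w /\ A (w * q)). split; [|split].
    + apply open_inter; [exact (H_open _ _ _ He)|]. now apply open_preimage_r.
    + exists (p * q^'). destruct (HA p Ap) as [_ [Hp _]]. split.
      * exact (H_mul PI _ _ _ _ _ Hp Hq').
      * rewrite <- mA. destruct Hq as [_ [_ ->]]. now rewrite (H_unit_r PI _ _ _ Hp).
    + intros w [Hw Aw]. split; [exact Hw|]. apply cl. intros N oN Nw.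
      destruct (HA _ Aw) as [_ [_ clw]].
      destruct (clw (fun v => N (q * v))) as [v [Nv Ov]]; [now apply open_preimage_l| |eauto].
      rewrite (inv_mul PI e e e w q Hw Hq), mA.
      destruct Hq as [_ [-> _]]. now rewrite (H_unit_l PI _ _ _ (H_inv PI _ _ _ Hw)).
Qed.

(** * Separating zero from the H-classes *)

Lemma zero_far_from_group e :
  Hc e e e -> exists W, is_open t W /\ W z /\ forall x, W x -> Hc e e x -> False.
Proof.
  intro He. apply NNPP. intro no.
  assert (ee : e * e = e) by exact (H_unit_l PI _ _ _ He).
  assert (oH := H_open _ _ _ He).
  assert (zz : forall x, x * z = z) by apply PI.
  assert (near : forall W, is_open t W -> W z -> exists x, W x /\ Hc e e x).
  { intros W oW Wz. apply NNPP. intro far. apply no. exists W. eauto 6. }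
  destruct (haus e z (proj1 He)) as [U0 [Z0 [oU0 [oZ0 [U0e [Z0z dis]]]]]].
  (* [U W4] lies in [W3], [U W3] in [W2], ..., [U W1] in [Z0]: so [U U U U W4] misses [U]. *)
  assert (absorb : forall W, is_open t W -> W z -> exists U W', is_open t U /\ is_open t W' /\
     U e /\ W' z /\ forall u w, U u -> W' w -> W (u * w)).
  { intros W oW Wz. apply jc; [exact oW | now rewrite zz]. }
  destruct (absorb Z0 oZ0 Z0z) as [U1 [W1 [oU1 [oW1 [U1e [W1z a1]]]]]].
  destruct (absorb W1 oW1 W1z) as [U2 [W2 [oU2 [oW2 [U2e [W2z a2]]]]]].
  destruct (absorb W2 oW2 W2z) as [U3 [W3 [oU3 [oW3 [U3e [W3z a3]]]]]].
  destruct (absorb W3 oW3 W3z) as [U4 [W4 [oU4 [oW4 [U4e [W4z a4]]]]]].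
  (* [W5] serves only to show that the cluster point found below is not zero. *)
  destruct (square_nbhd t m z Z0 jc oZ0) as [W5 [oW5 [W5z WW]]]; [now rewrite zz|].
  pose (U := fun x => U0 x /\ U1 x /\ U2 x /\ U3 x /\ U4 x).
  pose (W := fun x => W4 x /\ W5 x).
  assert (oU : is_open t U) by (repeat (apply open_inter; [assumption|]); assumption).
  assert (oW : is_open t W) by now apply open_inter.
  assert (Ue : U e) by (unfold U; auto).
  assert (UW : forall a b c d w, U a -> U b -> U c -> U d -> W w ->
            ~ U (a * (b * (c * (d * w))))).
  { intros a b c d w [_ [a_ _]] [_ [_ [b_ _]]] [_ [_ [_ [c_ _]]]] [_ [_ [_ [_ d_]]]] [w_ _] [u_ _].
    exact (dis _ u_ (a1 _ _ a_ (a2 _ _ b_ (a3 _ _ c_ (a4 _ _ d_ w_))))). }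
  destruct (inverse_in_closure e U He oU Ue) as [A [oA [[p Ap] HA]]].
  (* A state is a neighbourhood N_n of zero with a point k_n of H in it. The next neighbourhood
     keeps only the w with k_n' w in W, which holds at zero; all later k_j are therefore good for
     k_n. *)
  pose (P := fun s : (X -> Prop) * X =>
    is_open t (fst s) /\ fst s z /\ (forall x, fst s x -> W x) /\ fst s (snd s) /\ Hc e e (snd s)).
  pose (R := fun s s' : (X -> Prop) * X =>
    forall w, fst s' w -> fst s w /\ W ((snd s)^' * w)).
  destruct (near W oW) as [k0 [Wk0 Hk0]]; [split; auto|].
  destruct (dependent_choice _ P R (W, k0)) as [f Hf].
  - unfold P. simpl. split; [exact oW|]. split; [split; auto|]. auto.
  - intros [N k] [oN [Nz [NW [Nk Hk]]]]. unfold P, R. simpl in *.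
    pose (N' := fun w => N w /\ W (k^' * w)).
    assert (oN' : is_open t N').
    { apply open_inter; [exact oN|]. now apply open_preimage_l. }
    assert (N'z : N' z). { unfold N', W. rewrite zz. auto. }
    destruct (near N' oN' N'z) as [k1 [N'k1 Hk1]].
    exists (N', k1). simpl. split; [|auto].
    split; [exact oN'|]. split; [exact N'z|]. split; [|auto].
    intros w [Nw _]. auto.
  - pose (k := fun n => snd (f n)).
    assert (Hk : forall n, Hc e e (k n)) by (intro n; apply (Hf n)).
    assert (fk : forall n, fst (f n) (k n)).
    { intro n. destruct (Hf n) as [[_ [_ [_ [h _]]]] _]. exact h. }
    assert (dec : forall j n w, n <= j -> fst (f j) w -> fst (f n) w).
    { apply decreasing_le. intros n w fw. now apply (Hf n). }
    assert (kW : forall n j, n < j -> W ((k n)^' * k j)).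
    { intros n j lt. exact (proj2 (proj2 (Hf n) _ (dec j (S n) _ lt (fk j)))). }
    destruct (pseudocompact_cluster t (fun n w => Hc e e w /\ U (w * k n)) pc) as [y Hy].
    { intro n. split.
      - apply open_inter; [exact oH|]. now apply open_preimage_r.
      - exists ((k n)^'). split; [apply (H_inv PI), Hk|].
        now rewrite (proj2 (proj2 (Hk n))). }
    (* Near zero, w and k_n would both be in [W5], so w k_n would be in both Z0 and U0. *)
    assert (yz : y <> z).
    { intro ey. destruct (Hy W oW) with (N := 0) as [n [_ [w [Ww [_ Uw]]]]].
      { rewrite ey. split; auto. }
      apply (dis (w * k n)); [apply Uw|]. apply WW; [apply Ww|].
      destruct (Hf n) as [[_ [_ [fW _]]] _]. apply fW, fk. }
    (* The H-class of y is open and meets H, hence equals H. *)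
    assert (Hy' : Hc e e y).
    { assert (Hy0 : Hc (y * y^') (y^' * y) y) by (repeat split; auto).
      destruct (Hy _ (H_open _ _ _ Hy0) Hy0 0) as [n [_ [w [Hw [Hw' _]]]]].
      destruct Hw as [_ [ew fw]]. destruct Hw' as [_ [ew' fw']].
      repeat split; congruence. }
    assert (HyV := H_inv PI _ _ _ Hy').
    assert (Hp : Hc e e p) by apply (HA p Ap).
    (* The base point p of A stands in for e, which need not lie in A. Below, u near y is used
       through u y' p in A, and v near y, of larger index, through v y' in U. *)
    pose (N := fun w => U (w * y^') /\ A (w * (y^' * p))).
    assert (oN : is_open t N) by (apply open_inter; now apply open_preimage_r).
    assert (Ny : N y).
    { split.
      - now rewrite (proj1 (proj2 Hy')).
      - now rewrite mA, (proj1 (proj2 Hy')), (H_unit_l PI _ _ _ Hp). }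
    destruct (Hy N oN Ny 0) as [n [_ [u [[_ Au] [Hu Uu]]]]].
    destruct (Hy N oN Ny (S n)) as [j [lt [v [[Uv _] [Hv Uv']]]]].
    destruct (HA _ Au) as [_ [_ cl]]. destruct (HA p Ap) as [Up _].
    assert (HuV := H_inv PI _ _ _ Hu).
    assert (ea : (u * (y^' * p))^' = p^' * (y * u^')).
    { rewrite (inv_mul PI _ _ _ _ _ Hu (H_mul PI _ _ _ _ _ HyV Hp)).
      rewrite (inv_mul PI _ _ _ _ _ HyV Hp), (invK _ _ _ PI). symmetry. apply mA. }
    (* At a = (u y' p)' = p' y u' the product telescopes to v k_j, which is in U. That a is only in
       cl U, so it is replaced by a nearby a in U; now four factors from U and one from W multiply
       into U, against [UW]. *)
    destruct (cl (fun a => U (v * y^' * (p * (a * (u * k n * ((k n)^' * k j))))))) as [a [Uva Ua]].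
    + apply (open_preimage_r t m _ (fun a => U (v * y^' * (p * a))) jc).
      apply (open_preimage_l t m _ (fun a => U (v * y^' * a)) jc).
      now apply (open_preimage_l t m _ U jc).
    + rewrite ea.
      assert (ek : u * k n * ((k n)^' * k j) = u * k j).
      { rewrite <- mA, (mA (k n)), (proj1 (proj2 (Hk n))).
        now rewrite (H_unit_l PI _ _ _ (Hk j)). }
      assert (eu : u^' * (u * k j) = k j).
      { rewrite mA, (proj2 (proj2 Hu)). now rewrite (H_unit_l PI _ _ _ (Hk j)). }
      assert (ep : p * (p^' * (y * k j)) = y * k j).
      { rewrite mA, (proj1 (proj2 Hp)), mA. now rewrite (H_unit_l PI _ _ _ Hy'). }
      rewrite ek, <- !mA, eu, ep, (mA (y^')), (proj2 (proj2 Hy')).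
      now rewrite (H_unit_l PI _ _ _ (Hk j)).
    + exact (UW _ _ _ _ _ Uv Up Ua Uu (kW n j lt) Uva).
Qed.

(** Right multiplication by y' fixes zero and carries the class of y into the maximal subgroup at
    a. *)
Lemma zero_far_from_H a b :
  exists W, is_open t W /\ W z /\ forall x, W x -> Hc a b x -> False.
Proof.
  destruct (classic (exists y, Hc a b y)) as [[y Hy]|no].
  - destruct (zero_far_from_group a (H_idem_l PI _ _ _ Hy)) as [W [oW [Wz dis]]].
    exists (fun x => W (x * y^')). split; [|split].
    + now apply open_preimage_r.
    + now rewrite (mul0l _ _ _ PI).
    + intros x Wx Hx. apply (dis _ Wx). exact (H_mul PI _ _ _ _ _ Hx (H_inv PI _ _ _ Hy)).
  - exists (fun _ => True). split; [apply open_full|]. split; [auto|]. eauto.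
Qed.

(** A non-zero point outside the class has its own H-class as an open neighbourhood disjoint from
    it; zero is handled by [zero_far_from_H]. *)
Lemma H_closed a b : is_open t (fun x => ~ Hc a b x).
Proof.
  apply open_local. intros x nH. destruct (classic (x = z)) as [->|nz].
  - destruct (zero_far_from_H a b) as [W [oW [Wz dis]]]. exists W. eauto.
  - assert (Hx : Hc (x * x^') (x^' * x) x) by (repeat split; auto).
    exists (Hc (x * x^') (x^' * x)). split; [exact (H_open _ _ _ Hx)|]. split; [exact Hx|].
    intros y [_ [e1 e2]] [_ [e3 e4]]. apply nH. repeat split; congruence.
Qed.

(** * Neighbourhoods of zero contain almost all H-classes *)

Lemma dense_in_almost_all_H (V : X -> Prop) :
  is_open t V -> V z ->
  exists l : list (X * X), forall a b, ~ In (a, b) l ->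
    forall B, is_open t B -> (exists x, B x) -> (forall x, B x -> Hc a b x) ->
    exists x, B x /\ V x.
Proof.
  intros oV Vz.
  (* The interior of H_p \ V. Zero has the neighbourhood V, which meets none of these sets; any
     other point has its H-class, which meets at most one. *)
  pose (Z := fun (p : X * X) x => exists B, is_open t B /\ B x /\
    forall y, B y -> Hc (fst p) (snd p) y /\ ~ V y).
  destruct (pc (fun U => exists p, U = Z p /\ exists x, Z p x)) as [l Hl].
  - intros U [p [-> ne]]. split; [|exact ne]. apply open_local.
    intros x [B [oB [Bx HB]]]. exists B. repeat split; auto. intros y By. exists B. auto.
  - intro y. destruct (classic (y = z)) as [->|nz].
    + exists V. repeat split; auto. exists nil.
      intros U [[p [-> _]] [x [Vx [B [_ [Bx HB]]]]]]. exfalso. now apply (HB x).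
    + assert (Hy : Hc (y * y^') (y^' * y) y) by (repeat split; auto).
      exists (Hc (y * y^') (y^' * y)). split; [exact (H_open _ _ _ Hy)|]. split; [exact Hy|].
      exists (Z (y * y^', y^' * y) :: nil).
      intros U [[[a b] [-> _]] [x [Hx [B [_ [Bx HB]]]]]]. left. f_equal.
      destruct (HB x Bx) as [Hx' _]. simpl in Hx'.
      destruct Hx as [_ [<- <-]]. destruct Hx' as [_ [<- <-]]. reflexivity.
  (* Pseudocompactness bounds the number of sets; distinct H-classes are disjoint, so the non-empty
     sets determine their indices. *)
  - destruct (finite_preimage _ _ Z l (fun p => exists x, Z p x)) as [l' Hl'].
    + intros p ne. eauto.
    + intros [a b] [c d] [x Zx] _ e. assert (Zx' := Zx). rewrite e in Zx'.
      destruct Zx as [B [_ [Bx HB]]]. destruct Zx' as [B' [_ [Bx' HB']]].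
      destruct (HB x Bx) as [[_ [e1 e2]] _]. destruct (HB' x Bx') as [[_ [e3 e4]] _].
      simpl in *. congruence.
    + exists l'. intros a b nin B oB [x Bx] BH. apply NNPP. intro no.
      apply nin, Hl'. exists x, B. repeat split; auto; try apply (BH y); auto.
      intro Vy. apply no. eauto.
Qed.

Lemma zero_base (U : X -> Prop) :
  is_open t U -> U z ->
  exists l : list (X * X), forall x, x <> z -> ~ In (x * x^', x^' * x) l -> U x.
Proof.
  intros oU Uz.
  destruct (square_nbhd t m z U jc oU) as [V [oV [Vz VV]]]; [now rewrite (mul0l _ _ _ PI)|].
  destruct (dense_in_almost_all_H V oV Vz) as [l Hl].
  (* The product list excludes every (a, b) for which both (a, a) and (b, b) are in l, so one of the
     two diagonal classes is always available. *)
  exists (l ++ list_prod (map fst l) (map fst l)). intros x nz nin.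
  assert (Hx : Hc (x * x^') (x^' * x) x) by (repeat split; auto).
  assert (oH := H_open _ _ _ Hx).
  remember (x * x^') as a eqn:ea. remember (x^' * x) as b eqn:eb.
  assert (inV : forall c, Hc c c c -> ~ In (c, c) l -> exists A, is_open t A /\
            (exists p, A p) /\ forall w, A w -> Hc c c w /\ V (w^')).
  { intros c Hcc ninc.
    destruct (inverse_open_image c (fun w => Hc c c w /\ V w)) as [A [oA [neA HA]]].
    - apply open_inter; [exact (H_open _ _ _ Hcc) | exact oV].
    - destruct (Hl c c ninc (Hc c c)) as [w [Hw Vw]]; eauto. exact (H_open _ _ _ Hcc).
    - tauto.
    - exists A. repeat split; auto; try apply HA; auto. }
  assert (ninab : ~ In (a, b) l).
  { intro i. apply nin, in_or_app. now left. }
  destruct (classic (In (a, a) l)) as [ia|na]; [destruct (classic (In (b, b) l)) as [ib|nb]|].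
  - exfalso. apply nin, in_or_app. right. apply in_prod.
    + now apply (in_map fst) in ia.
    + now apply (in_map fst) in ib.
  - destruct (inV b (H_idem_r PI _ _ _ Hx) nb) as [A [oA [[p Ap] HA]]].
    (* For w in V with x' w in A, also w' x = (x' w)' is in V, and x = w (w' x) is in V V. *)
    destruct (Hl a b ninab (fun w => Hc a b w /\ A (x^' * w))) as [w [[Hw Aw] Vw]].
    + apply open_inter; [exact oH|]. now apply open_preimage_l.
    + exists (x * p). destruct (HA p Ap) as [Hp _]. split.
      * exact (H_mul PI _ _ _ _ _ Hx Hp).
      * now rewrite mA, <- eb, (H_unit_l PI _ _ _ Hp).
    + tauto.
    + destruct (HA _ Aw) as [_ Vi].
      rewrite (inv_mul PI _ _ _ _ _ (H_inv PI _ _ _ Hx) Hw), (invK _ _ _ PI) in Vi.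
      rewrite <- (H_unit_l PI _ _ _ Hx), <- (proj1 (proj2 Hw)), <- mA. auto.
  - destruct (inV a (H_idem_l PI _ _ _ Hx) na) as [A [oA [[p Ap] HA]]].
    (* The mirror image: x = (x w') w. *)
    destruct (Hl a b ninab (fun w => Hc a b w /\ A (w * x^'))) as [w [[Hw Aw] Vw]].
    + apply open_inter; [exact oH|]. now apply open_preimage_r.
    + exists (p * x). destruct (HA p Ap) as [Hp _]. split.
      * exact (H_mul PI _ _ _ _ _ Hp Hx).
      * now rewrite <- mA, <- ea, (H_unit_r PI _ _ _ Hp).
    + tauto.
    + destruct (HA _ Aw) as [_ Vi].
      rewrite (inv_mul PI _ _ _ _ _ Hw (H_inv PI _ _ _ Hx)), (invK _ _ _ PI) in Vi.
      rewrite <- (H_unit_r PI _ _ _ Hx), <- (proj2 (proj2 Hw)), mA. auto.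
Qed.

End TopologicalPrimitiveInverse.

(** * Orthogonal sums of Brandt semigroups as primitive inverse semigroups *)

Section OrthogonalSum.
Context {I : Type} {L : I -> Type} {G : I -> Group}.

Definition osum_elt (i : I) (a : L i) (g : G i) (b : L i) : OSum L G :=
  Some (existT (BTriple L G) i (a, g, b)).

Definition osum_inv (x : OSum L G) : OSum L G :=
  match x with
  | Some (existT _ i (a, g, b)) => osum_elt i b (ginv (G i) g) a
  | None => None
  end.

Lemma osum_cases (x : OSum L G) : x = None \/ exists i a g b, x = osum_elt i a g b.
Proof. destruct x as [[i [[a g] b]]|]; [right; now exists i, a, g, b | now left]. Qed.

Lemma osum_mul_elt i (a b c : L i) (g h : G i) :
  osum_mul (osum_elt i a g b) (osum_elt i b h c) = osum_elt i a (gmul (G i) g h) c.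
Proof.
  unfold osum_mul, osum_elt.
  destruct (excluded_middle_informative (i = i)) as [e|n]; [|contradiction].
  rewrite (UIP_refl _ _ e). cbn.
  destruct (excluded_middle_informative (b = b)) as [_|n]; [reflexivity | contradiction].
Qed.

(** Equality of dependent pairs avoids transports: the idempotent (b, 1, b) is a function of the
    pair (i, b), which yields [primitive] directly. *)
Lemma osum_mul_neq_None i j (a b : L i) (c d : L j) (g : G i) (h : G j) :
  osum_mul (osum_elt i a g b) (osum_elt j c h d) <> None ->
  existT L i b = existT L j c.
Proof.
  unfold osum_mul, osum_elt. intro nz.
  destruct (excluded_middle_informative (i = j)) as [e|n]; [|contradiction].
  destruct e. cbn in nz.
  destruct (excluded_middle_informative (b = c)) as [->|n]; [reflexivity | contradiction].
Qed.

Lemma osum_mul_None_r (x : OSum L G) : osum_mul x None = None.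
Proof. destruct x as [[i [[a g] b]]|]; reflexivity. Qed.

Lemma osum_mul_inv_r i (a b : L i) (g : G i) :
  osum_mul (osum_elt i a g b) (osum_inv (osum_elt i a g b)) = osum_elt i a (gone (G i)) a.
Proof. now rewrite <- (gmul_Vr (G i) g), <- (osum_mul_elt i a b a). Qed.

Lemma osum_mul_inv_l i (a b : L i) (g : G i) :
  osum_mul (osum_inv (osum_elt i a g b)) (osum_elt i a g b) = osum_elt i b (gone (G i)) b.
Proof. now rewrite <- (gmul_Vl (G i) g), <- (osum_mul_elt i b a b). Qed.

Lemma ginv_inv (K : Group) (g : K) : ginv K (ginv K g) = g.
Proof.
  rewrite <- (gmul_1l K (ginv K (ginv K g))), <- (gmul_Vr K g), <- gmul_assoc, gmul_Vr.
  apply gmul_1r.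
Qed.

(** Associativity is a premise because the theorem supplies it as part of being a topological
    semigroup. *)
Lemma osum_primitive_inverse :
  (forall x y w : OSum L G, osum_mul x (osum_mul y w) = osum_mul (osum_mul x y) w) ->
  primitive_inverse (@osum_mul I L G) None osum_inv.
Proof.
  intro assoc. split.
  - exact assoc.
  - reflexivity.
  - exact osum_mul_None_r.
  - intro x. destruct (osum_cases x) as [->|[i [a [g [b ->]]]]]; [reflexivity|].
    now rewrite osum_mul_inv_r, osum_mul_elt, gmul_1l.
  - intro x. destruct (osum_cases x) as [->|[i [a [g [b ->]]]]]; [reflexivity|].
    cbn. now rewrite ginv_inv.
  - intros x y nz.
    destruct (osum_cases x) as [->|[i [a [g [b ->]]]]]; [now destruct nz|].
    destruct (osum_cases y) as [->|[j [c [h [d ->]]]]]; [now destruct nz|].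
    rewrite osum_mul_inv_l, osum_mul_inv_r.
    exact (f_equal (fun p => osum_elt (projT1 p) (projT2 p) (gone _) (projT2 p))
             (osum_mul_neq_None _ _ _ _ _ _ _ _ nz)).
Qed.

(** Dictionary between the indices of the sets in the theorem and the pairs of idempotents that
    index [Hclass]. *)
Definition Hsub_ends (t : {i : I & (L i * L i)%type}) : OSum L G * OSum L G :=
  match t with
  | existT _ i (a, b) => (osum_elt i a (gone (G i)) a, osum_elt i b (gone (G i)) b)
  end.

Lemma osum_elt_idem_inj i j (a : L i) (b : L j) :
  osum_elt i a (gone (G i)) a = osum_elt j b (gone (G j)) b -> existT L i a = existT L j b.
Proof.
  intro e.
  exact (f_equal (fun x : OSum L G => match x with
    | Some (existT _ k (c, _, _)) => existT L k c | None => existT L i a end) e).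
Qed.

Lemma Hsub_ends_inj t t' : Hsub_ends t = Hsub_ends t' -> t = t'.
Proof.
  destruct t as [i [a b]], t' as [j [c d]]. cbn. intro e.
  assert (e1 := osum_elt_idem_inj _ _ _ _ (f_equal fst e)).
  assert (e2 := osum_elt_idem_inj _ _ _ _ (f_equal snd e)).
  assert (eij : i = j) by exact (f_equal (@projT1 _ _) e1). destruct eij.
  apply inj_pair2 in e1, e2. congruence.
Qed.

Lemma Hsub_Hclass t x :
  Hsub t x <-> Hclass (@osum_mul I L G) None osum_inv (fst (Hsub_ends t)) (snd (Hsub_ends t)) x.
Proof.
  destruct t as [i [a b]]. cbn [Hsub Hsub_ends fst snd]. split.
  - intros [g ->]. split; [discriminate|].
    split; [apply osum_mul_inv_r | apply osum_mul_inv_l].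
  - intros [nz [ea eb]]. destruct (osum_cases x) as [->|[j [c [g [d ->]]]]]; [now destruct nz|].
    rewrite osum_mul_inv_r in ea. rewrite osum_mul_inv_l in eb.
    apply osum_elt_idem_inj in ea, eb.
    assert (eij : j = i) by exact (f_equal (@projT1 _ _) ea). destruct eij.
    apply inj_pair2 in ea, eb. subst. exists g. reflexivity.
Qed.

Lemma Hsub_cover (x : OSum L G) : x <> None -> exists t, Hsub t x.
Proof.
  destruct x as [[i [[a g] b]]|]; [|now intros []]. intros _.
  exists (existT _ i (a, b)). now exists g.
Qed.

End OrthogonalSum.

Theorem theorem3p7 (I : Type) (L : I -> Type) (G : I -> Group)
  (HL : forall i, inhabited (L i))
  (tau : topology (OSum L G))
  (Hsg : topological_semigroup tau (@osum_mul I L G))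
  (Hqr : quasiregular tau)
  (Hpc : pseudocompact tau) :
  (forall ts : list {i : I & (L i * L i)%type},
     is_open tau (fun x => ~ exists t, In t ts /\ @Hsub I L G t x) /\
     (~ exists t, In t ts /\ @Hsub I L G t None)) /\
  (forall U, is_open tau U -> U None ->
     exists ts : list {i : I & (L i * L i)%type},
       forall x, (~ exists t, In t ts /\ @Hsub I L G t x) -> U x).
Proof.
  destruct Hsg as [haus [assoc jc]].
  assert (PI := osum_primitive_inverse assoc).
  split.
  - intro ts. split.
    + induction ts as [|s ts IH].
      * apply open_local. intros x _. exists (fun _ => True).
        split; [apply open_full|]. split; [auto|]. intros y _ [t [[] _]].
      * apply open_local. intros x Hx.
        eexists. split; [apply open_inter; [exact IH|] |].
        { exact (H_closed tau PI haus jc Hqr Hpc (fst (Hsub_ends s)) (snd (Hsub_ends s))). }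
        split.
        { split.
          - intros [t [i Ht]]. apply Hx. exists t. split; [now right | exact Ht].
          - intro Hs. apply Hx. exists s. split; [now left | now apply Hsub_Hclass]. }
        intros y [no nH] [t [[<-|i] Ht]]; [now apply Hsub_Hclass in Ht | eauto].
    + intros [t [_ Ht]]. apply Hsub_Hclass in Ht. now apply (proj1 Ht).
  - intros U oU U0.
    destruct (zero_base tau PI haus jc Hqr Hpc U oU U0) as [l Hl].
    (* The pairs in l are arbitrary pairs of elements; only those of the form [Hsub_ends t] matter,
       and injectivity pulls them back to finitely many indices. *)
    destruct (finite_preimage _ _ Hsub_ends l (fun t => In (Hsub_ends t) l)) as [ts Hts].
    + auto.
    + intros t t' _ _. apply Hsub_ends_inj.
    + exists ts. intros x no. destruct (classic (x = None)) as [->|nz]; [exact U0|].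
      apply Hl; [exact nz|]. intro i. destruct (Hsub_cover x nz) as [t Ht].
      apply no. exists t. split; [|exact Ht]. apply Hts.
      apply Hsub_Hclass in Ht. destruct Ht as [_ [e1 e2]].
      rewrite e1, e2 in i. now rewrite <- surjective_pairing in i.
Qed.
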